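(* Let $\hat W=(\hat w_i)_{i=1}^N$ be the anchor weights of a frozen 4-bit artifact, $\Delta_i=u_i-\ell_i$ the writable width of the cell $C_i=[\ell_i,u_i]\ni\hat w_i$ of weight $i$, and $F$ the Fisher information of the model at $\hat W$. For $|\delta_i|\le\rho\,\Delta_i/2$ (all $i$), $$\mathbb E_x\,\mathrm{KL}\!\left(p_{\hat W}\,\|\,p_{\hat W+\delta}\right)=\tfrac12\,\delta^\top F\,\delta+O(\|\delta\|^3),$$ so to second order the drift of any update confined to that box is controlled by the Fisher form on radii supplied by the quantization grid, and scales as $\rho^2$. Which updates the hypothesis covers: (a) An update confined to the symmetric box $|\delta_i|\le\mathrm{room}_i=\min(\hat w_i-\ell_i,\;u_i-\hat w_i)$ (the bounded fill) is covered directly, since $\mathrm{room}_i\le\Delta_i/2$. (b) An update produced by clamping each weight to the full cell $[\ell_i,u_i]$ (the projected paths) is not: a weight may then travel up to $\max(\hat w_i-\ell_i,\;u_i-\hat w_i)$, which exceeds $\Delta_i/2$ wherever the cell is asymmetric about its anchor. For the non-uniform NF4 level table this is the case for fourteen of the sixteen codes (the two extreme codes are symmetric only because capping mirrors their inner half-gap). For such updates the proposition bounds the symmetric part of the excursion and not the whole of it.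
   Context: Artifact and cells. Levels $L[0]<\dots<L[15]$ (NF4: $-1$, $-0.6961928$, $-0.5250731$, $-0.3949175$, $-0.2844414$, $-0.1847734$, $-0.0910500$, $0$, $0.0795803$, $0.1609302$, $0.2461123$, $0.3379152$, $0.4407098$, $0.5626170$, $0.7229568$, $1$). Each weight $i$ has a frozen code $a_i\in\{0,\dots,15\}$ and a frozen block scale $s_{g(i)}>0$; its anchor is $\hat w_i=s_{g(i)}L[a_i]$. In units of the scale, the cell of a code is bounded by the midpoints between its level and the neighbouring levels; the two outer cells, which would be half-infinite, are capped by mirroring the inner half-gap about the level. If $[\mathrm{lo}_i,\mathrm{hi}_i]$ is the resulting capped cell (multiplied by the scale) and $W_i=\mathrm{hi}_i-\mathrm{lo}_i$, the writable cell is $C_i=[\ell_i,u_i]$ with $\ell_i=\mathrm{lo}_i+\mu W_i$, $u_i=\mathrm{hi}_i-\mu W_i$, $\mu=1\%$. Write $\mathcal C=\prod_i C_i$. Model. $p_W(y\mid x)$ is the conditional output distribution of a language model with weights $W$ (a softmax head over a network smooth in its weights); $p_W(y\mid x)>0$ and $W\mapsto\log p_W(y\mid x)$ is $C^3$ on a neighbourhood of the compact box $\mathcal C$. Inputs $x$ are drawn from a fixed distribution $\mathcal D$, and $\mathbb E_x$ is expectation over it; $\mathrm{KL}(p_{\hat W}\|p_{\hat W+\delta})$ is the Kullback–Leibler divergence between the output distributions given $x$; $F=\mathbb E_{x}\,\mathbb E_{y\sim p_{\hat W}(\cdot\mid x)}\big[\nabla_W\log p_W(y\mid x)\,\nabla_W\log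 p_W(y\mid x)^\top\big]$ at $W=\hat W$. The number $\rho$ is a radius parameter (fraction of the cell half-width used).
   Formalization: Added assumption: the Fisher information is finite, and the third weight-derivatives of log p are dominated, on each compact subset of the smoothness neighbourhood, by an integrable function of x; without it the averaged remainder need not be O(‖δ‖³) (heavy-tailed inputs). *)

(* Defs.v *)
From HB Require Import structures.
From mathcomp Require Export all_boot all_order all_algebra.
From mathcomp Require Export all_classical all_reals all_analysis.
Set Implicit Arguments.
Unset Strict Implicit.
Unset Printing Implicit Defensive.
Export Order.TTheory GRing.Theory Num.Theory.
Export numFieldNormedType.Exports.
Local Open Scope classical_set_scope.
Local Open Scope ring_scope.

Section Levels.
Variable R : realType.

(* [dec [:: d1; ...; dn]] is the decimal 0.d1...dn. *)
Definition dec (ds : seq nat) : R := foldr (fun d x => (d%:R + x) / 10) 0 ds.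

Definition nf4 : 16.-tuple R := [tuple
  -1;
  - dec [:: 6; 9; 6; 1; 9; 2; 8];
  - dec [:: 5; 2; 5; 0; 7; 3; 1];
  - dec [:: 3; 9; 4; 9; 1; 7; 5];
  - dec [:: 2; 8; 4; 4; 4; 1; 4];
  - dec [:: 1; 8; 4; 7; 7; 3; 4];
  - dec [:: 0; 9; 1; 0; 5; 0; 0];
  0;
  dec [:: 0; 7; 9; 5; 8; 0; 3];
  dec [:: 1; 6; 0; 9; 3; 0; 2];
  dec [:: 2; 4; 6; 1; 1; 2; 3];
  dec [:: 3; 3; 7; 9; 1; 5; 2];
  dec [:: 4; 4; 0; 7; 0; 9; 8];
  dec [:: 5; 6; 2; 6; 1; 7; 0];
  dec [:: 7; 2; 2; 9; 5; 6; 8];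
  1].

Definition mu : R := 1 / 100.

Variables (L : 16.-tuple R) (s : R) (a : 'I_16).

Definition midpoint (k : nat) : R := (L`_k + L`_k.+1) / 2.

(* Ends of the capped cell of [a], in units of the scale.  The lower end of the
   first cell and the upper end of the last one would be infinite; they are the
   mirror images, about the level, of the other end of the same cell. *)
Definition unit_lo : R :=
  if a == 0%N :> nat then L`_0 - (midpoint 0 - L`_0) else midpoint a.-1.
Definition unit_hi : R :=
  if a == 15%N :> nat then L`_15 + (L`_15 - midpoint 14) else midpoint a.

Definition lo : R := s * unit_lo.
Definition hi : R := s * unit_hi.
Definition cell_anchor : R := s * L`_a.
Definition cell_ell : R := lo + mu * (hi - lo).
Definition cell_u : R := hi - mu * (hi - lo).
Definition cell_asymmetric : bool :=
  cell_anchor - cell_ell != cell_u - cell_anchor.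

End Levels.

Record artifact (R : realType) (N : nat) := Artifact {
  level : 16.-tuple R;
  code : 'I_N -> 'I_16;
  nblock : nat;
  block : 'I_N -> 'I_nblock;
  scale : 'I_nblock -> R;
  level_increasing : sorted <%R level;
  scale_gt0 : forall b, 0 < scale b }.
Arguments block {R N}.
Arguments scale {R N}.

Section Artifact.
Variables (R : realType) (N : nat) (A : artifact R N).

Definition weight_scale (i : 'I_N) : R := scale A (block A i).

Definition anchor : 'rV[R]_N :=
  \row_i cell_anchor (level A) (weight_scale i) (code A i).
Definition ell (i : 'I_N) : R := cell_ell (level A) (weight_scale i) (code A i).
Definition upp (i : 'I_N) : R := cell_u (level A) (weight_scale i) (code A i).
Definition asymmetric (i : 'I_N) : bool :=
  cell_asymmetric (level A) (weight_scale i) (code A i).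

Definition cells : set 'rV[R]_N :=
  [set w | forall i, ell i <= w ord0 i <= upp i].

Definition Delta (i : 'I_N) : R := upp i - ell i.
Definition room (i : 'I_N) : R :=
  Num.min (anchor ord0 i - ell i) (upp i - anchor ord0 i).
Definition reach (i : 'I_N) : R :=
  Num.max (anchor ord0 i - ell i) (upp i - anchor ord0 i).

Definition box (rho : R) : set 'rV[R]_N :=
  [set delta | forall i, `|delta ord0 i| <= rho * Delta i / 2].
Definition bounded_fill : set 'rV[R]_N :=
  [set delta | forall i, `|delta ord0 i| <= room i].

(* The update obtained by clamping the proposed weights [V] to the cells. *)
Definition projected_update (V : 'rV[R]_N) : 'rV[R]_N :=
  \row_i Num.max (ell i) (Num.min (V ord0 i) (upp i)) - anchor.

(* The part of [delta] lying within the symmetric box of half-widths [t]. *)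
Definition symmetric_part (t : 'I_N -> R) (delta : 'rV[R]_N) : 'rV[R]_N :=
  \row_i Num.max (- t i) (Num.min (delta ord0 i) (t i)).

End Artifact.

Section Smoothness.
Variables (R : realType) (N : nat).
Implicit Types (f : 'rV[R]_N -> R) (w : 'rV[R]_N) (U : set 'rV[R]_N).

Definition partial (i : 'I_N) f : 'rV[R]_N -> R :=
  fun w => 'D_(delta_mx ord0 i) f w.

Definition grad f w : 'rV[R]_N := \row_i partial i f w.

(* Class C^k on the open set [U]. *)
Fixpoint Ck (k : nat) U f : Prop :=
  {in U, continuous f} /\
  match k with
  | 0%N => True
  | k'.+1 => forall i, {in U, forall w, derivable f w (delta_mx ord0 i)} /\
                       Ck k' U (partial i f)
  end.

(* Euclidean norm; the library's norm on ['rV] is the maximum norm. *)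
Definition enorm w : R := Num.sqrt (\sum_i w ord0 i ^+ 2).

(* [w^T F w], for row vectors. *)
Definition quad (F : 'M[R]_N) w : R := (w *m F *m w^T) ord0 ord0.

End Smoothness.

Section Model.
Variables (R : realType) (N : nat).
Variables (d : measure_display) (X : measurableType d) (D : probability X R).
Variable Y : finType.
(* [p W x y] is the probability of the output [y] given the input [x]. *)
Variable p : 'rV[R]_N -> X -> Y -> R.
Implicit Types (W delta : 'rV[R]_N) (U S : set 'rV[R]_N).

Definition log_p (x : X) (y : Y) : 'rV[R]_N -> R := fun W => ln (p W x y).

Record smooth_model U : Prop := SmoothModel {
  p_ge0 : forall W x y, 0 <= p W x y;
  p_sum1 : forall W x, \sum_y p W x y = 1;
  p_measurable : forall W y, measurable_fun [set: X] (fun x => p W x y);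
  p_gt0 : forall W, U W -> forall x y, 0 < p W x y;
  log_p_C3 : forall x y, Ck 3 U (log_p x y) }.

(* Integrand, as a function of [x], of the [(i, j)] entry of the Fisher
   information at [W]. *)
Definition fisher_at W (i j : 'I_N) (x : X) : R :=
  \sum_y p W x y * ((grad (log_p x y) W)^T *m grad (log_p x y) W) i j.

Definition fisher W : 'M[R]_N := \matrix_(i, j) fine 'E_D[fisher_at W i j]%E.

(* Existence of the expectation over the inputs in the Fisher information, and
   third derivatives locally dominated, uniformly in the weights, by an
   integrable function of the input.  Without the latter the pointwise C^3
   hypothesis gives no control on the remainder once averaged over the inputs.
   Both are automatic for finitely many inputs: see
   [finite_inputs_regular_expectations]. *)
Record regular_expectations U W : Prop := RegularExpectations {
  fisher_integrable : forall i j,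
    D.-integrable [set: X] (EFin \o fisher_at W i j);
  third_derivatives_dominated : forall Q : set 'rV[R]_N,
    compact Q -> Q `<=` U ->
    exists2 G : X -> R, D.-integrable [set: X] (EFin \o G) &
      forall V, Q V -> forall x y i j k,
        `|partial i (partial j (partial k (log_p x y))) V| <= G x }.

Definition KL (q r : Y -> R) : R := \sum_y q y * ln (q y / r y).

(* Extended-real valued: a bound on the drift below includes its finiteness. *)
Definition drift W delta : \bar R := 'E_D[fun x => KL (p W x) (p (W + delta) x)]%E.

Definition fisher_drift W delta : R := quad (fisher W) delta / 2.

(* drift = fisher_drift + O(||delta||^3), uniformly over [delta] in [S]. *)
Definition fisher_expansion_on W S : Prop :=
  exists K : R, forall delta, S delta ->
    (`|drift W delta - (fisher_drift W delta)%:E|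
       <= (K * enorm delta ^+ 3)%:E)%E.

End Model.

Section FiniteInputs.
Variables (R : realType) (N : nat).
Variables (d : measure_display) (X : measurableType d) (D : probability X R).
Variables (Y : finType) (p : 'rV[R]_N -> X -> Y -> R).

Lemma finite_inputs_regular_expectations (U : set 'rV[R]_N) (W : 'rV[R]_N) :
  finite_set [set: X] -> (forall S : set X, measurable S) ->
  smooth_model p U -> regular_expectations D p U W.
Proof.
move=> finX mX [_ _ _ _ C3].
have intX (f : X -> R) : D.-integrable [set: X] (EFin \o f).
  have [B HB] : exists B : R, forall x, `|f x| <= B.
    have finI : finite_set (f @` [set: X]) by exact: finite_image.
    exists (\sum_(r \in f @` [set: X]) `|r|) => x.
    rewrite (fsbigID [set f x])//= addrC -[leLHS]add0r lerD//.
      by rewrite fsumr_ge0.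
    rewrite (_ : _ `&` _ = [set f x]) ?fsbig_set1//.
    by apply/seteqP; split => [r []|r /= ->]//; split => //; exists x.
  apply: (@le_integrable _ _ _ _ _ measurableT _ (cst B%:E)) => //.
  - by move=> x _; rewrite /= lee_fin (le_trans (HB x)) ?ler_norm.
  - by apply/integrableP; split => //; rewrite integral_cst//= probability_setT mule1 ltry.
split=> [i j|Q cQ QU]; first exact: intX.
have bnd x y i j k : {B : R | forall V, Q V ->
    `|partial i (partial j (partial k (log_p p x y))) V| <= B}.
  apply: cid.
  have cont : {in U, continuous (partial i (partial j (partial k (log_p p x y))))}.
    by case: (C3 x y) => _ /(_ k)[_ [_ /(_ j)[_ [_ /(_ i)[_ []]]]]].
  have := compact_bounded (continuous_compact
    (f := partial i (partial j (partial k (log_p p x y)))) _ cQ).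
  case.
    by apply/continuous_in_subspaceT => w /set_mem/QU Uw; apply: cont; exact/mem_set.
  move=> M [_ /(_ (M + 1))] HM; exists (M + 1) => V QV.
  by apply: HM; [rewrite ltrDl|exists V].
exists (fun x => \sum_y \sum_i \sum_j \sum_k `|sval (bnd x y i j k)|) => //.
move=> V QV x y i j k.
apply: le_trans (svalP (bnd x y i j k) V QV) _; apply: le_trans (ler_norm _) _.
have le1 (I : finType) (F : I -> R) a : (forall b, 0 <= F b) -> F a <= \sum_b F b.
  by move=> F0; rewrite (bigD1 a)//= lerDl sumr_ge0.
have ge0 (I : finType) (F : I -> R) : (forall b, 0 <= F b) -> 0 <= \sum_b F b.
  by move=> F0; rewrite sumr_ge0.
set F := fun y i j k => `|sval (bnd x y i j k)|.
have F0 y' i' j' k' : 0 <= F y' i' j' k' by exact: normr_ge0.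
apply: le_trans (le1 _ (F y i j) k (F0 _ _ _)) _.
apply: le_trans (le1 _ (fun j => \sum_k F y i j k) j (fun=> ge0 _ _ (F0 _ _ _))) _.
apply: le_trans (le1 _ (fun i => \sum_j \sum_k F y i j k) i
  (fun=> ge0 _ _ (fun=> ge0 _ _ (F0 _ _ _)))) _.
by apply: (le1 _ (fun y => \sum_i \sum_j \sum_k F y i j k) y) => b;
  do 3 (apply: (ge0) => ?).
Qed.

End FiniteInputs.

(* Main.v *)
Require Import Defs.
From mathcomp Require Import measurable_realfun ring lra.
Set Implicit Arguments.
Unset Strict Implicit.
Unset Printing Implicit Defensive.
Local Open Scope classical_set_scope.
Local Open Scope ring_scope.

(* Fix an input and expand each [t |-> log p (W + t w)] at [0] to second order.
   Differentiating [sum_y p = 1] twice shows that the mean score vanishes and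
   that the mean Hessian is minus the mean squared score, so the KL divergence
   is half the mean squared score up to a cubic remainder.  On a compact
   rectangle inside the smoothness domain the third derivatives are dominated by
   an integrable function of the input, so the remainder survives averaging with
   a uniform constant.  Since the partial derivatives are all that is given, the
   derivative along [w] is recovered by moving one coordinate at a time. *)

(** * Calculus along a line *)

Section Calculus.
Variable R : realType.

Lemma bounded_of_bounded_derivative (f df : R -> R) (M : R) :
  (forall t : R, 0 <= t <= 1 -> is_derive t 1 f (df t)) -> f 0 = 0 ->
  (forall t : R, 0 <= t <= 1 -> `|df t| <= M) ->
  forall t : R, 0 <= t <= 1 -> `|f t| <= M.
Proof.
move=> fdf f0 dfM t /andP[t0 t1].
have [c| |c] := @MVT_segment R f df 0 t t0.
- by rewrite in_itv/= => /andP[c0 ct]; apply: fdf; rewrite (ltW c0) (le_trans (ltW ct)).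
- apply: derivable_within_continuous => c; rewrite in_itv/= => /andP[c0 ct].
  by apply: @ex_derive; apply: fdf; rewrite c0 (le_trans ct).
rewrite in_itv/= f0 !subr0 => /andP[c0 ct] ->.
rewrite normrM (ger0_norm t0); apply: le_trans (dfM c _).
  by rewrite ler_piMr.
by rewrite c0 (le_trans ct).
Qed.

(** The Taylor remainder [g] and its first two derivatives [g1], [g2] all vanish at 0, so the bound
    on [f3] passes up through three mean value estimates on [[0, 1]]. Integrating would give
    [M / 6], but any constant serves. *)
Lemma taylor2_bound (f f1 f2 f3 : R -> R) (M : R) :
  (forall t : R, 0 <= t <= 1 -> is_derive t 1 f (f1 t)) ->
  (forall t : R, 0 <= t <= 1 -> is_derive t 1 f1 (f2 t)) ->
  (forall t : R, 0 <= t <= 1 -> is_derive t 1 f2 (f3 t)) ->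
  (forall t : R, 0 <= t <= 1 -> `|f3 t| <= M) ->
  `|f 1 - f 0 - f1 0 - f2 0 / 2| <= M.
Proof.
move=> df df1 df2 f3M.
pose g2 t := f2 t - f2 0.
pose g1 t := f1 t - f1 0 - t * f2 0.
pose g t := f t - f 0 - t * f1 0 - t ^+ 2 / 2 * f2 0.
have g2M : forall t : R, 0 <= t <= 1 -> `|g2 t| <= M.
  apply: (@bounded_of_bounded_derivative _ f3) => // [t t01|]; last by rewrite /g2 subrr.
  by have := df2 _ t01 => H; rewrite /g2; apply: is_derive_eq; rewrite subr0.
have g1M : forall t : R, 0 <= t <= 1 -> `|g1 t| <= M.
  apply: (@bounded_of_bounded_derivative _ g2) => // [t t01|]; last by rewrite /g1 subrr mul0r subrr.
  have := df1 _ t01 => H; rewrite /g1 /g2; apply: is_derive_eq.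
  by rewrite /GRing.scale /= /cst; ring.
have gM : forall t : R, 0 <= t <= 1 -> `|g t| <= M.
  apply: (@bounded_of_bounded_derivative _ g1) => // [t t01|]; last by rewrite /g /=; ring.
  have := df _ t01 => H; rewrite /g /g1; apply: is_derive_eq.
  by rewrite /GRing.scale /=; field.
have := gM 1; rewrite ler01 lexx => /(_ isT).
by rewrite /g; congr (`| _ | <= _); field.
Qed.

Variable V : normedModType R.
Implicit Types (f : V -> R) (v u w : V).

(** The two difference quotients are the same function of [h], which reduces directional derivatives
    to calculus in one real variable. *)
Lemma is_derive_line f v w (t l : R) :
  is_derive (t *: w + v) w f l <-> is_derive t 1 (fun s : R => f (s *: w + v)) l.
Proof.
have E : (fun h => h^-1 *: ((f \o shift (t *: w + v)) (h *: w) - f (t *: w + v))) =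
   (fun h => h^-1 *: (((fun s : R => f (s *: w + v)) \o shift t) (h *: 1) - f (t *: w + v))).
  by apply/funext => h /=; rewrite (_ : h *: 1 = h) ?scalerDl ?addrA//; exact: mulr1.
by split=> -[ex dE]; split; move: ex dE; rewrite /derivable /derive E.
Qed.

Lemma is_derive_line0 f v w (l : R) :
  is_derive v w f l <-> is_derive (0 : R) 1 (fun s : R => f (s *: w + v)) l.
Proof. by rewrite -is_derive_line scale0r add0r. Qed.

Lemma is_derive_scale f v w (c l : R) :
  is_derive v w f l -> is_derive v (c *: w) f (c * l).
Proof.
move=> /is_derive_line0 H; apply/is_derive_line0.
rewrite (_ : (fun _ => _) = (fun s : R => f (s *: w + v)) \o (fun s : R => s * c)); last first.
  by apply/funext => s /=; rewrite scalerA.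
have H' : is_derive ((fun s : R => s * c) 0) 1 (fun s : R => f (s *: w + v)) l by rewrite mul0r.
have H2 : is_derive (0 : R) 1 (fun s : R => s * c) c.
  by apply: is_derive_eq; rewrite /GRing.scale/=; ring.
by rewrite mulrC; exact: is_derive1_comp.
Qed.

(* The increment along [w] is handled by the mean value theorem, so that only
   [w] needs derivatives in a neighbourhood of [v]. *)
Lemma is_derive_dirD f (g : V -> R) v u w (l : R) :
  is_derive v u f l -> (\forall x \near v, is_derive x w f (g x)) ->
  {for v, continuous g} ->
  is_derive v (u + w) f (l + g v).
Proof.
move=> fu fw cw.
have key : h^-1 *: (f (h *: w + (h *: u + v)) - f (h *: u + v)) @[h --> (0 : R)^'] --> g v.
  apply/cvgrPdist_le => e e0.
  have /nbhs_ballP[r /= r0 Hr] : \forall x \near v, is_derive x w f (g x) /\ `|g v - g x| <= e.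
    by near=> x; split; near: x => //; move/cvgrPdist_le: cw; exact.
  (* When [|h|] is below [r] divided by this quantity, the segment from [h *: u + v] to
     [h *: w + (h *: u + v)] stays in the ball of radius [r]; the added 1 keeps the divisor
     positive. *)
  have n0 : 0 < `|u| + `|w| + 1 by rewrite ltr_wpDl ?addr_ge0.
  near=> h.
  have hne0 : h != 0 by near: h; exact: nbhs_dnbhs_neq.
  have hr : `|h| < r / (`|u| + `|w| + 1).
    near: h; apply: (@nbhs_dnbhs _ (0 : R)).
    have := @nbhs0_lt _ R (r / (`|u| + `|w| + 1)); apply; exact: divr_gt0.
  have Hb (t : R) : 0 <= t <= 1 -> ball v r (t *: (h *: w) + (h *: u + v)).
    move=> /andP[t0 t1]; rewrite -ball_normE /ball_/= addrA opprD addrCA subrr addr0 normrN.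
    rewrite (le_lt_trans (ler_normD _ _))// !normrZ (ger0_norm t0).
    rewrite (@le_lt_trans _ _ (`|h| * (`|u| + `|w| + 1)))//; last by rewrite -ltr_pdivlMr.
    rewrite mulrDr mulrDr mulr1 addrC -addrA lerD2l.
    by rewrite ler_wpDr// ler_piMl// mulr_ge0.
  pose k (t : R) := f (t *: (h *: w) + (h *: u + v)).
  have dg (t : R) : 0 <= t <= 1 ->
      is_derive t 1 k (h * g (t *: (h *: w) + (h *: u + v))).
    move=> t01; apply/is_derive_line/is_derive_scale.
    by have [] := Hr _ (Hb _ t01).
  have [c| |c] := @MVT_segment R k (fun t => h * g (t *: (h *: w) + (h *: u + v))) 0 1 ler01.
  - by rewrite in_itv/= => /andP[/ltW c0 /ltW c1]; apply: dg; rewrite c0.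
  - apply: derivable_within_continuous => c; rewrite in_itv/= => c01.
    by apply: @ex_derive; exact: dg.
  rewrite in_itv/= /k scale1r scale0r add0r => c01 ->.
  rewrite subr0 mulr1 [X in g v - X]mulKf//.
  by have [] := Hr _ (Hb _ c01).
have [fuex fuE] := fu.
(* Going from [v] to [v + h (u + w)] by way of [v + h u] splits the quotient into one tending to [l]
   and one tending to [g v]. *)
have E : (fun h : R => h^-1 *: ((f \o shift v) (h *: u) - f v)) \+
      (fun h => h^-1 *: (f (h *: w + (h *: u + v)) - f (h *: u + v))) =
   (fun h : R => h^-1 *: ((f \o shift v) (h *: (u + w)) - f v)).
  apply/funext => h /=; rewrite -scalerDr addrC addrA subrK.
  by rewrite addrA [h *: (u + w)]scalerDr (addrC (h *: u)).
have H : h^-1 *: ((f \o shift v) (h *: (u + w)) - f v) @[h --> (0 : R)^'] --> l + g v.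
  by rewrite -E -fuE; exact: cvgD fuex key.
split; first exact: cvgP H.
exact: cvg_lim H.
Unshelve. all: by end_near. Qed.

Lemma is_derive_lincomb (I : finType) (c : I -> R) (h : I -> V -> R)
    (dh : I -> R) v w :
  (forall i, is_derive v w (h i) (dh i)) ->
  is_derive v w (fun x => \sum_i c i * h i x) (\sum_i c i * dh i).
Proof.
move=> H; rewrite (_ : (fun _ => _) = \sum_i (c i \*: h i)).
  by elim/big_ind2: _ => [|? ? ? ? *|i _]; [exact: is_derive_cst|exact: is_deriveD|exact: is_deriveZ].
by apply/funext => x; rewrite fct_sumE.
Qed.

Lemma is_derive_near_cst f (c : R) v w (l : R) :
  (\forall x \near v, f x = c) -> is_derive v w f l -> l = 0.
Proof.
move=> fc [_ <-].
by rewrite (near_eq_derive (g := cst c)) ?derive_cst.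
Qed.

End Calculus.

(** * Mean score and mean Hessian of a normalised density *)

Section Density.
Variables (R : realType) (Y : finType) (T : set R) (f f1 f2 : Y -> R -> R).
Hypothesis oT : open T.
Hypothesis T0 : T 0.
Hypothesis df : forall t y, T t -> is_derive t 1 (f y) (f1 y t).
Hypothesis df1 : forall t y, T t -> is_derive t 1 (f1 y) (f2 y t).
Hypothesis sum1 : forall t, T t -> \sum_y expR (f y t) = 1.

Lemma mean_score t : T t -> \sum_y expR (f y t) * f1 y t = 0.
Proof.
move=> Tt; apply: (@is_derive_near_cst _ _ (fun t => \sum_y 1 * expR (f y t)) 1 t 1).
  apply: filterS (open_nbhs_nbhs (conj oT Tt)) => s Ts.
  by rewrite -[RHS](sum1 Ts); apply: eq_bigr => y _; rewrite mul1r.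
rewrite (_ : \sum_y _ = \sum_y 1 * (expR (f y t) * f1 y t)); last first.
  by apply: eq_bigr => y _; rewrite mul1r.
apply: is_derive_lincomb => y; have := df y Tt => H.
exact: (is_derive1_comp (is_derive_expR (f y t)) H).
Qed.

(** The mean score is zero on a whole neighbourhood of 0, so its derivative, the mean of
    [f2 + f1 ^+ 2], is zero as well. *)
Lemma mean_hessian :
  \sum_y expR (f y 0) * f2 y 0 = - \sum_y expR (f y 0) * f1 y 0 ^+ 2.
Proof.
apply/eqP; rewrite -addr_eq0 -big_split/=; apply/eqP.
apply: (@is_derive_near_cst _ _ (fun t => \sum_y 1 * (expR (f y t) * f1 y t)) 0 0 1).
  apply: filterS (open_nbhs_nbhs (conj oT T0)) => s Ts.
  by rewrite -[RHS](mean_score Ts); apply: eq_bigr => y _; rewrite mul1r.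
rewrite (_ : \sum_y _ = \sum_y 1 * (expR (f y 0) * f2 y 0
                                     + f1 y 0 * (expR (f y 0) * f1 y 0)));
  last first.
  by apply: eq_bigr => y _; ring.
apply: is_derive_lincomb => y; have H := df y T0; have H1 := df1 y T0.
exact: (is_deriveM (is_derive1_comp (is_derive_expR (f y 0)) H) H1).
Qed.

End Density.

(** * Directional derivatives from continuous partial derivatives *)

Section DirectionalDerivatives.
Variables (R : realType) (N : nat) (U : set 'rV[R]_N).
Hypothesis oU : open U.
Implicit Types (f : 'rV[R]_N -> R) (v w : 'rV[R]_N).

Definition ddir w f v : R := \sum_i w ord0 i * partial i f v.

Lemma Ck_continuous k f : Ck k U f -> {in U, continuous f}.
Proof. by case: k => [|k] []. Qed.

Lemma is_derive_ddir k f v w : Ck k.+1 U f -> U v -> is_derive v w f (ddir w f v).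
Proof.
move=> [_ Cf] Uv; rewrite [X in is_derive _ X]row_sum_delta /ddir.
(* Induction on the coordinates already moved. The new one plays the role of [w] in
   [is_derive_dirD], since its partial derivative exists near [v] and is continuous; the earlier
   ones only need the derivative at [v]. *)
elim: (index_enum _) => [|i s IH]; first by rewrite !big_nil; exact: is_derive0.
rewrite !big_cons addrC [X in is_derive _ _ _ X]addrC.
apply: (is_derive_dirD (g := fun x => w ord0 i * partial i f x)) => //.
  near=> x; apply: is_derive_scale; apply: derivableP.
  have [/(_ x) Dx _] := Cf i; apply: Dx; apply/mem_set; near: x.
  exact: open_nbhs_nbhs.
have [_ /Ck_continuous/(_ v) cf] := Cf i.
exact: (continuousM (@cst_continuous _ _ (w ord0 i) v) (cf (mem_set Uv))).
Unshelve. all: by end_near. Qed.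

End DirectionalDerivatives.

(** * Expansion of the Kullback-Leibler divergence *)

Section PointwiseExpansion.
Variables (R : realType) (N : nat) (U : set 'rV[R]_N).
Hypothesis oU : open U.
Variables (d : measure_display) (X : measurableType d) (Y : finType).
Variable p : 'rV[R]_N -> X -> Y -> R.
Hypothesis hp : smooth_model p U.
Implicit Types (f : 'rV[R]_N -> R) (v w : 'rV[R]_N).

(** The Hessian and the third-derivative tensor evaluated on copies of [w], nested so that each is a
    linear combination of derivatives of lower order. *)
Definition ddir2 w f v : R := \sum_k w ord0 k * ddir w (partial k f) v.
Definition ddir3 w f v : R := \sum_k w ord0 k * ddir2 w (partial k f) v.

Lemma Ck_partial k f i : Ck k.+1 U f -> Ck k U (partial i f).
Proof. by move=> [_ /(_ i)[]]. Qed.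

Lemma is_derive_ddir2 k f v w :
  Ck k.+2 U f -> U v -> is_derive v w (ddir w f) (ddir2 w f v).
Proof.
move=> Cf Uv; apply: (@is_derive_lincomb _ _ _ _ (fun i => partial i f)) => i.
exact: (is_derive_ddir oU _ (Ck_partial i Cf) Uv).
Qed.

Lemma is_derive_ddir3 k f v w :
  Ck k.+3 U f -> U v -> is_derive v w (ddir2 w f) (ddir3 w f v).
Proof.
move=> Cf Uv; apply: (@is_derive_lincomb _ _ _ _ (fun i => ddir w (partial i f))) => i.
exact: (is_derive_ddir2 _ (Ck_partial i Cf) Uv).
Qed.

Lemma ddir3_bound f v w (G : R) :
  (forall i j k, `|partial i (partial j (partial k f)) v| <= G) ->
  `|ddir3 w f v| <= G * (\sum_i `|w ord0 i|) ^+ 3.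
Proof.
have step (h : 'I_N -> R) B : (forall i, `|h i| <= B) ->
    `|\sum_i w ord0 i * h i| <= B * \sum_i `|w ord0 i|.
  move=> hB; rewrite mulr_sumr; apply: le_trans (ler_norm_sum _ _ _) _.
  by apply: ler_sum => i _; rewrite normrM mulrC ler_wpM2r.
move=> H; rewrite !exprS expr0 mulr1 !mulrA.
by apply: (step) => k; apply: (step) => j; apply: (step).
Qed.

Lemma expR_log_p W x y : U W -> expR (log_p p x y W) = p W x y.
Proof. by move=> UW; rewrite /log_p lnK// posrE (p_gt0 hp). Qed.

(* The first two Taylor terms of [log p] are averaged exactly, and only the
   cubic remainder is estimated. *)
Lemma KL_expansion W w x (G : R) :
  (forall t : R, 0 <= t <= 1 -> U (t *: w + W)) ->
  (forall t : R, 0 <= t <= 1 -> forall y i j k,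
    `|partial i (partial j (partial k (log_p p x y))) (t *: w + W)| <= G) ->
  `|KL (p W x) (p (W + w) x) - (\sum_y p W x y * ddir w (log_p p x y) W ^+ 2) / 2|
    <= G * (\sum_i `|w ord0 i|) ^+ 3.
Proof.
move=> lineU HG.
have UW : U W by have := lineU 0; rewrite scale0r add0r lexx ler01; exact.
have UWw : U (W + w) by have := lineU 1; rewrite scale1r addrC lexx ler01; exact.
(* The identities for the density need an open set of parameters around 0, which the closed segment
   is not. *)
pose T : set R := (fun t : R => t *: w + W) @^-1` U.
have oT : open T.
  apply: open_comp => // t _ /=; apply: cvgD; last exact: cvg_cst.
  by apply: cvgZr_tmp; exact: cvg_id.
have T0 : T 0 by rewrite /T/= scale0r add0r.
pose f y t := log_p p x y (t *: w + W).
pose f1 y t := ddir w (log_p p x y) (t *: w + W).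
pose f2 y t := ddir2 w (log_p p x y) (t *: w + W).
pose f3 y t := ddir3 w (log_p p x y) (t *: w + W).
have C3 y := log_p_C3 hp x y.
have df (t : R) y : T t -> is_derive t 1 (f y) (f1 y t).
  by move=> Tt; have := is_derive_ddir oU w (C3 y) Tt; move/is_derive_line.
have df1 (t : R) y : T t -> is_derive t 1 (f1 y) (f2 y t).
  by move=> Tt; have := is_derive_ddir2 w (C3 y) Tt; move/is_derive_line.
have df2 (t : R) y : T t -> is_derive t 1 (f2 y) (f3 y t).
  by move=> Tt; have := is_derive_ddir3 w (C3 y) Tt; move/is_derive_line.
have sum1 (t : R) : T t -> \sum_y expR (f y t) = 1.
  by move=> Tt; rewrite -[RHS](p_sum1 hp (t *: w + W) x); apply: eq_bigr => y _; exact: expR_log_p.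
have := mean_score oT df sum1 T0; have := mean_hessian oT T0 df df1 sum1.
have q0 y : expR (f y 0) = p W x y by rewrite /f scale0r add0r expR_log_p.
under eq_bigr do rewrite q0.
under [X in _ = - X -> _]eq_bigr do rewrite q0.
move=> hess; under eq_bigr do rewrite q0.
move=> score.
set B := G * _.
have taylor y : `|f y 1 - f y 0 - f1 y 0 - f2 y 0 / 2| <= B.
  apply: (@taylor2_bound _ (f y) (f1 y) (f2 y) (f3 y)) => t t01.
  - by apply: df; exact: lineU.
  - by apply: df1; exact: lineU.
  - by apply: df2; exact: lineU.
  - by apply: ddir3_bound => i j k; exact: HG.
(* The error is exactly minus the mean Taylor remainder: the first-order term averages to 0 and the
   second-order one to minus half the mean squared score. *)
rewrite (_ : _ - _ = - \sum_y p W x y * (f y 1 - f y 0 - f1 y 0 - f2 y 0 / 2)); last first.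
  rewrite -(_ : \sum_y (p W x y * (f y 1 - f y 0) - p W x y * f1 y 0
                        - (p W x y * f2 y 0) / 2)
                = \sum_y p W x y * (f y 1 - f y 0 - f1 y 0 - f2 y 0 / 2));
    last first.
    by apply: eq_bigr => y _; field.
  rewrite !sumrB score subr0 -mulr_suml hess mulNr opprK opprD; congr (_ - _).
    rewrite /KL -sumrN; apply: eq_bigr => y _.
    rewrite lnM ?posrE ?invr_gt0 ?(p_gt0 hp)// lnV ?posrE ?(p_gt0 hp)//.
    by rewrite /f scale1r scale0r add0r (addrC w) /log_p; ring.
  congr (_ * _); apply: eq_bigr => y _.
  by rewrite /f1 scale0r add0r.
rewrite normrN; apply: le_trans (ler_norm_sum _ _ _) _.
(* The total mass 1 distributes the bound over the outputs, so their number does not enter the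
   constant. *)
rewrite -[leRHS]mul1r -[X in _ <= X * _](p_sum1 hp W x) mulr_suml; apply: ler_sum => y _.
rewrite normrM (ger0_norm (p_ge0 hp _ _ _)).
by apply: ler_wpM2l; [exact: (p_ge0 hp)|exact: taylor].
Qed.

End PointwiseExpansion.

(** * Averaging the expansion over the inputs *)

Section AveragedExpansion.
Variables (R : realType) (N : nat).
Variables (d : measure_display) (X : measurableType d) (D : probability X R).
Variables (Y : finType) (p : 'rV[R]_N -> X -> Y -> R).
Variables (U : set 'rV[R]_N) (W : 'rV[R]_N).
Hypothesis oU : open U.
Hypothesis hp : smooth_model p U.
Hypothesis hreg : regular_expectations D p U W.

Lemma measurable_KL V : U W -> U V ->
  measurable_fun [set: X] (fun x => KL (p W x) (p V x)).
Proof.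
move=> UW UV; rewrite (_ : (fun _ => _) =
    fun x => \sum_y p W x y * (ln (p W x y) - ln (p V x y))).
  apply: measurable_sum => y.
  have mp V' := p_measurable hp V' y.
  by apply: measurable_funM => //; apply: measurable_funB;
    apply: (measurableT_comp (@measurable_ln R)).
apply/funext => x; apply: eq_bigr => y _.
by rewrite lnM ?posrE ?invr_gt0 ?(p_gt0 hp)// lnV ?posrE ?(p_gt0 hp).
Qed.

Definition score_sq w x : R := \sum_y p W x y * ddir w (log_p p x y) W ^+ 2.

(** Expanding the square and exchanging sums shows [score_sq] to be the Fisher quadratic form before
    averaging over [x]. *)
Lemma score_sqE w x :
  score_sq w x = \sum_i \sum_j (w ord0 i * w ord0 j) * fisher_at p W i j x.
Proof.
rewrite /score_sq /fisher_at.
under [RHS]eq_bigr do under eq_bigr do rewrite mulr_sumr.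
under [RHS]eq_bigr do rewrite exchange_big.
rewrite [RHS]exchange_big; apply: eq_bigr => y _ /=.
rewrite expr2 {1}/ddir mulr_suml mulr_sumr; apply: eq_bigr => i _.
rewrite /ddir mulr_sumr mulr_sumr; apply: eq_bigr => j _.
by rewrite !mxE big_ord_recl big_ord0 !mxE; ring.
Qed.

Lemma score_sq_EFinE w :
  (fun x => (score_sq w x)%:E) = (fun x => \sum_i \sum_j
    (w ord0 i * w ord0 j)%:E * (fisher_at p W i j x)%:E)%E.
Proof.
apply/funext => x; rewrite score_sqE -sumEFin; apply: eq_bigr => i _.
by rewrite -sumEFin.
Qed.

Lemma integrable_score_sq w :
  D.-integrable [set: X] (fun x => (score_sq w x)%:E).
Proof.
rewrite score_sq_EFinE; apply: integrable_sum => // i _; apply: integrable_sum => // j _.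
exact: integrableZl (fisher_integrable hreg i j).
Qed.

Lemma expectation_score_sq w :
  (\int[D]_x (score_sq w x)%:E = (quad (fisher D p W) w)%:E)%E.
Proof.
rewrite score_sq_EFinE integral_sum//; last first.
  move=> i; apply: integrable_sum => // j _.
  exact: integrableZl (fisher_integrable hreg i j).
rewrite /quad mxE -sumEFin.
under [RHS]eq_bigr do rewrite mxE mulr_suml -sumEFin.
rewrite [RHS]exchange_big/=; apply: eq_bigr => i _.
rewrite integral_sum//; last first.
  by move=> j; exact: integrableZl (fisher_integrable hreg i j).
apply: eq_bigr => j _.
rewrite integralZl//; last exact: fisher_integrable hreg i j.
(* Integrability makes the expectation finite, so the [fine] in [fisher] loses nothing. *)
rewrite !mxE unlock -[in LHS](fineK (x := \int[D]_x _)); last first.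
  exact: integrable_fin_num (fisher_integrable hreg i j).
by rewrite -EFinM; congr EFin; rewrite mulrAC.
Qed.

Lemma norm_coord_le_enorm (w : 'rV[R]_N) i : `|w ord0 i| <= enorm w.
Proof.
rewrite -sqrtr_sqr ler_wsqrtr// (bigD1 i)//= lerDl.
by apply: sumr_ge0 => j _; exact: sqr_ge0.
Qed.

Lemma norm1_le_enorm (w : 'rV[R]_N) : \sum_i `|w ord0 i| <= N%:R * enorm w.
Proof.
apply: (le_trans (ler_sum _ (fun i _ => norm_coord_le_enorm w i))).
by rewrite sumr_const card_ord mulr_natl.
Qed.

(** A single compact set containing every segment from [W] yields a single dominating function,
    hence a constant valid for all of [S]. *)
Lemma fisher_expansion_on_compact (Q S : set 'rV[R]_N) :
  compact Q -> Q `<=` U ->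
  (forall w, S w -> forall t : R, 0 <= t <= 1 -> Q (t *: w + W)) ->
  fisher_expansion_on D p W S.
Proof.
move=> cQ QU SQ; have [G iG HG] := third_derivatives_dominated hreg cQ QU.
(* The pointwise remainder involves the cube of the sum of the [|w_i|]; comparing that sum with the
   Euclidean norm costs the factor [N ^+ 3]. *)
exists (fine (\int[D]_x `|(G x)%:E|)%E * N%:R ^+ 3) => w Sw.
set B := (\sum_i `|w ord0 i|) ^+ 3.
have B0 : 0 <= B by rewrite exprn_ge0// sumr_ge0.
have intG := integrable_abse iG.
pose e x := KL (p W x) (p (W + w) x) - score_sq w x / 2.
have eB x : `|e x| <= `|G x| * B.
  apply: le_trans (KL_expansion oU hp _ _) _ => [t t01|t t01 y i j k|].
  - by apply: QU; exact: SQ.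
  - by apply: HG; exact: SQ.
  - by rewrite ler_wpM2r// ler_norm.
have ie : D.-integrable [set: X] (fun x => (e x)%:E).
  apply: (@le_integrable _ _ _ _ _ measurableT _ (fun x => B%:E * `|(G x)%:E|)%E) => //.
  - apply/measurable_EFinP; apply: measurable_funB.
      apply: measurable_KL; apply: QU.
        by rewrite -[W]add0r -(scale0r w); apply: SQ; rewrite ?lexx ?ler01.
      by rewrite -[X in W + X]scale1r addrC; apply: SQ; rewrite ?lexx ?ler01.
    apply: measurable_funM => //; apply/measurable_EFinP.
    exact: measurable_int (integrable_score_sq w).
  - move=> x _; rewrite /= lee_fin normrM normr_id (ger0_norm B0) mulrC.
    exact: eB.
  - exact: integrableZl.
have is2 : D.-integrable [set: X] (fun x => (2^-1)%:E * (score_sq w x)%:E)%E.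
  by apply: integrableZl => //; exact: integrable_score_sq.
(* Both summands are integrable, so the extended-real integral splits and the drift is finite. *)
have driftE : drift D p W w = (\int[D]_x (e x)%:E + (fisher_drift D p W w)%:E)%E.
  rewrite /drift unlock (_ : (fun x => _) = (fun x => (e x)%:E + (2^-1)%:E * (score_sq w x)%:E)%E).
    rewrite integralD// integralZl//; last exact: integrable_score_sq.
    by rewrite expectation_score_sq -EFinM /fisher_drift mulrC.
  by apply/funext => x; rewrite -EFinM -EFinD /e; congr EFin; field.
rewrite driftE addeK//.
apply: le_trans (le_abse_integral _ _ (measurable_int _ ie)) _ => //.
apply: (@le_trans _ _ (\int[D]_x (B%:E * `|(G x)%:E|))%E).
  apply: ge0_le_integral => //.
  - by apply: measurableT_comp => //; exact: measurable_int ie.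
  - exact: measurable_int (integrableZl _ _ intG).
  - by move=> x _; rewrite /= lee_fin mulrC; exact: eB.
rewrite integralZl// -(fineK (integrable_fin_num _ intG))// -EFinM lee_fin.
rewrite mulrC -mulrA -exprMn ler_wpM2l//.
  by rewrite fine_ge0 //; apply: integral_ge0 => x _; exact: abse_ge0.
by rewrite lerXn2r// ?nnegrE ?sumr_ge0 ?mulr_ge0 ?sqrtr_ge0// norm1_le_enorm.
Qed.

End AveragedExpansion.

(** * Boxes and cells *)

Section Clamping.
Variables (R : realType) (l a u : R).
Hypothesis lau : l <= a <= u.

Lemma min_room_le : Num.min (a - l) (u - a) <= (u - l) / 2.
Proof. by case: (leP (a - l) (u - a)); lra. Qed.

Lemma norm_clamp_le v :
  `|Num.max l (Num.min v u) - a| <= Num.max (a - l) (u - a).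
Proof.
move: lau => /andP[? ?]; rewrite ler_norml.
by case: (leP (a - l) (u - a)) => ?; case: (leP v u) => ?;
  [case: (leP l v)|case: (leP l u)|case: (leP l v)|case: (leP l u)] => ?;
  apply/andP; split; lra.
Qed.

Lemma norm_clamp_farthest :
  `|Num.max l (Num.min (if a - l <= u - a then u else l) u) - a|
    = Num.max (a - l) (u - a).
Proof.
move: lau => /andP[? ?].
case: (leP (a - l) (u - a)) => ?.
  by rewrite minxx max_r ?ger0_norm; lra.
by rewrite min_l ?maxxx ?ler0_norm; lra.
Qed.

(** Half the width is the mean of the two distances, and a maximum exceeds the mean exactly when the
    terms differ. *)
Lemma half_lt_max : ((u - l) / 2 < Num.max (a - l) (u - a)) = (a - l != u - a).
Proof.
apply/idP/idP; first by apply: contraTneq => e; rewrite e maxxx -leNgt; lra.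
by rewrite neq_lt => /orP[?|?]; [rewrite max_r|rewrite max_l]; lra.
Qed.

Lemma norm_symmetric_clamp_le (t x : R) :
  0 <= t -> `|Num.max (- t) (Num.min x t)| <= t.
Proof.
move=> t0; rewrite ler_norml.
by case: (leP x t) => ?; [case: (leP (- t) x)|case: (leP (- t) t)] => ?; apply/andP; split; lra.
Qed.

(** Truncating a displacement symmetrically shrinks it towards 0, so the end point stays between [a]
    and a point of [[l, u]]. *)
Lemma symmetric_clamp_in (t v : R) : 0 <= t ->
  l <= a + Num.max (- t) (Num.min (Num.max l (Num.min v u) - a) t) <= u.
Proof.
move: lau => /andP[? ?] t0.
have : l <= Num.max l (Num.min v u) <= u.
  by rewrite le_max lexx ge_max ge_min lexx orbT andbT/=; lra.
move: (Num.max l _) => b /andP[? ?].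
by case: (leP (b - a) t) => ?; [case: (leP (- t) (b - a))|case: (leP (- t) t)] => ?;
  apply/andP; split; lra.
Qed.

End Clamping.

Section Rectangles.
Variables (R : realType) (N : nat).
Implicit Types (lo hi : 'I_N -> R) (w v W : 'rV[R]_N).

(** Compact and convex; it covers the product of the cells, a small neighbourhood of the anchor, and
    the box of radius [rho] around it. *)
Definition rect lo hi : set 'rV[R]_N :=
  [set v | forall i, lo i <= v ord0 i <= hi i].

Lemma compact_rect lo hi : compact (rect lo hi).
Proof.
have := @rV_compact R N (fun i => `[lo i, hi i]%classic) (fun i => @segment_compact _ _ _).
by congr compact; apply/seteqP; split => v /= H i; have := H i; rewrite /= in_itv.
Qed.

Lemma rect_segment lo hi W w (t : R) : rect lo hi W -> rect lo hi (W + w) ->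
  0 <= t <= 1 -> rect lo hi (t *: w + W).
Proof.
move=> HW HWw /andP[t0 t1] i; have := HW i; have := HWw i; rewrite !mxE.
by move=> /andP[? ?] /andP[? ?]; apply/andP; split; nra.
Qed.

Lemma open_rect (U : set 'rV[R]_N) W : open U -> U W ->
  exists2 r : R, 0 < r &
    rect (fun i => W ord0 i - r) (fun i => W ord0 i + r) `<=` U.
Proof.
move=> oU UW.
have /nbhs_ballP[e /= e0 eU] := open_nbhs_nbhs (conj oU UW).
(* Halving the radius turns the closed bounds into the strict ones of the ball. *)
exists (e / 2); first by rewrite divr_gt0.
move=> v Hv; apply: eU; split=> // i j; rewrite (ord1 i).
rewrite -ball_normE/= /ball_ ltr_norml.
by have /andP[? ?] := Hv j; apply/andP; split; lra.
Qed.

End Rectangles.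

(** * The Fisher form and its scaling with the radius *)

Section FisherDrift.
Variables (R : realType) (N : nat).
Variables (d : measure_display) (X : measurableType d) (D : probability X R).
Variables (Y : finType) (p : 'rV[R]_N -> X -> Y -> R) (W : 'rV[R]_N).
Implicit Types (w : 'rV[R]_N) (S T : set 'rV[R]_N).

Lemma fisher_expansion_onS S T : S `<=` T ->
  fisher_expansion_on D p W T -> fisher_expansion_on D p W S.
Proof. by move=> ST [K HK]; exists K => w /ST/HK. Qed.

Lemma fisher_expansion_on_rect (U : set 'rV[R]_N) (lo hi : 'I_N -> R) :
  open U -> smooth_model p U -> regular_expectations D p U W ->
  rect lo hi `<=` U -> rect lo hi W ->
  fisher_expansion_on D p W [set w | rect lo hi (W + w)].
Proof.
move=> oU hp hreg rU rW.
apply: (fisher_expansion_on_compact oU hp hreg (@compact_rect _ _ lo hi) rU).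
by move=> w rw t t01; exact: rect_segment.
Qed.

Lemma fisher_driftZ (c : R) w :
  fisher_drift D p W (c *: w) = c ^+ 2 * fisher_drift D p W w.
Proof.
rewrite /fisher_drift /quad -!scalemxAl linearZ /= -scalemxAr !mxE.
by rewrite !mulrA expr2.
Qed.

Lemma fisher_drift0 : fisher_drift D p W 0 = 0.
Proof. by rewrite -(scale0r (0 : 'rV[R]_N)) fisher_driftZ expr0n mul0r. Qed.

(** Ensures that the real [sup] over a box is a genuine supremum and not the default value 0. *)
Lemma fisher_drift_bounded (b : 'I_N -> R) :
  exists B : R, forall w, (forall i, `|w ord0 i| <= b i) ->
    fisher_drift D p W w <= B.
Proof.
exists ((\sum_j \sum_i b i * `|fisher D p W i j| * b j) / 2) => w wb.
rewrite ler_wpM2r ?invr_ge0// /quad mxE; apply: ler_sum => j _.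
rewrite !mxE mulr_suml; apply: ler_sum => i _.
apply: (le_trans (ler_norm _)); rewrite !normrM.
by apply: ler_pM => //; apply: ler_wpM2r.
Qed.

End FisherDrift.

Section Scaling.
Variables (R : realType) (N : nat) (A : artifact R N).
Variables (d : measure_display) (X : measurableType d) (D : probability X R).
Variables (Y : finType) (p : 'rV[R]_N -> X -> Y -> R).
Hypothesis hA : cells A (anchor A).
Implicit Types (rho : R) (w : 'rV[R]_N).

Local Notation W := (anchor A).
Local Notation drift2 := (fisher_drift D p W).
Let M rho := sup [set drift2 w | w in box A rho].

Lemma Delta_ge0 i : 0 <= Delta A i.
Proof. by have /andP[? ?] := hA i; rewrite /Delta; lra. Qed.

Lemma box0 rho : 0 <= rho -> box A rho 0.
Proof.
move=> rho0 i; rewrite mxE normr0 divr_ge0// mulr_ge0//; exact: Delta_ge0.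
Qed.

Lemma boxZ rho c w : 0 <= c -> box A rho w -> box A (c * rho) (c *: w).
Proof.
move=> c0 bw i; rewrite mxE normrM (ger0_norm c0) -!mulrA ler_wpM2l// mulrA.
exact: bw.
Qed.

Lemma box_rho0 w : box A 0 w -> w = 0.
Proof.
move=> bw; apply/rowP => i; have := bw i.
by rewrite !mul0r normr_le0 mxE => /eqP.
Qed.

(** The form is homogeneous of degree 2 and [rho^-1 *: w] lies in the box of radius 1; a zero radius
    leaves only the zero update. *)
Lemma fisher_drift_le rho w : 0 <= rho -> box A rho w -> drift2 w <= rho ^+ 2 * M 1.
Proof.
move=> rho0 bw; have [e0|rhoN0] := eqVneq rho 0.
  by rewrite e0 in bw *; rewrite (box_rho0 bw) fisher_drift0 expr0n mul0r.
rewrite -[w](scalerKV rhoN0) fisher_driftZ ler_wpM2l ?sqr_ge0//.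
apply: ub_le_sup.
  have [B HB] := fisher_drift_bounded D p W (fun i => 1 * Delta A i / 2).
  by exists B => _ [v bv <-]; exact: HB.
exists (rho^-1 *: w) => //; rewrite -(mulVf rhoN0); apply: boxZ => //.
by rewrite invr_ge0.
Qed.

Lemma sup_fisher_driftE rho : 0 <= rho -> M rho = rho ^+ 2 * M 1.
Proof.
move=> rho0; apply/eqP; rewrite eq_le; apply/andP; split.
  apply: ge_sup; first by exists (drift2 0), 0 => //; exact: box0.
  by move=> _ [w bw <-]; exact: fisher_drift_le.
have ub : has_ubound [set drift2 w | w in box A rho].
  by exists (rho ^+ 2 * M 1) => _ [w bw <-]; exact: fisher_drift_le.
have [e0|rhoN0] := eqVneq rho 0.
  rewrite [X in X ^+ 2]e0 expr0n mul0r -(fisher_drift0 D p W); apply: ub_le_sup => //.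
  by exists 0 => //; exact: box0.
rewrite -ler_pdivlMl ?exprn_gt0 ?lt0r ?rhoN0//.
apply: ge_sup; first by exists (drift2 0), 0 => //; exact: box0.
move=> _ [w bw <-]; rewrite ler_pdivlMl ?exprn_gt0 ?lt0r ?rhoN0//.
rewrite -fisher_driftZ; apply: ub_le_sup => //; exists (rho *: w) => //.
by rewrite -[X in box A X](mulr1 rho); exact: boxZ.
Qed.

Lemma enorm_box rho w : 0 <= rho -> box A rho w ->
  enorm w <= rho * enorm (\row_i (Delta A i / 2)).
Proof.
move=> rho0 bw; rewrite -[X in X * _](ger0_norm rho0) -(sqrtr_sqr rho).
rewrite -sqrtrM ?sqr_ge0// ler_wsqrtr// mulr_sumr; apply: ler_sum => i _.
rewrite mxE -exprMn -real_normK ?num_real// mulrA.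
by rewrite lerXn2r ?nnegrE ?(le_trans _ (bw i)).
Qed.

Lemma ereal_dist_fin (x : \bar R) (r e : R) :
  (`|x - r%:E| <= e%:E)%E -> exists2 s, x = s%:E & `|s - r| <= e.
Proof. by case: x => [s| |]//=; rewrite lee_fin => H; exists s. Qed.

(** On a small box the drift and the Fisher drift differ by at most [e], uniformly, so their suprema
    do too. *)
Lemma ereal_sup_drift_scaling (r : R) : 0 < r ->
  fisher_expansion_on D p W [set w | box A 1 w /\ enorm w <= r] ->
  exists K rho0 : R, 0 < rho0 /\ forall rho, 0 <= rho <= rho0 ->
    (`|ereal_sup [set drift D p W w | w in box A rho] - (rho ^+ 2 * M 1)%:E|
      <= (K * rho ^+ 3)%:E)%E.
Proof.
move=> r0 [K HK]; set C := enorm (\row_i (Delta A i / 2)).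
have C0 : 0 <= C by exact: sqrtr_ge0.
(* Updates in the box have norm at most [rho * C], so this radius keeps them both in the box of
   radius 1 and within distance [r]. [C + 1] avoids dividing by 0, and [|K|] is taken because the
   sign of [K] is unknown. *)
exists (`|K| * C ^+ 3), (Num.min 1 (r / (C + 1))); split.
  by rewrite lt_min ltr01 divr_gt0// ltr_wpDl.
move=> rho /andP[rho0]; rewrite le_min => /andP[rho1].
rewrite ler_pdivlMr ?ltr_wpDl// => rhor.
set e := `|K| * C ^+ 3 * rho ^+ 3.
have near w : box A rho w -> exists2 s, drift D p W w = s%:E &
    `|s - drift2 w| <= e.
  move=> bw; have ew := enorm_box rho0 bw.
  have /HK/ereal_dist_fin[] : box A 1 w /\ enorm w <= r.
    split; last by apply: le_trans ew _; apply: le_trans rhor; rewrite ler_wpM2l// lerDl.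
    move=> i; apply: le_trans (bw i) _; rewrite ler_wpM2r ?invr_ge0// ler_wpM2r//.
    exact: Delta_ge0.
  move=> s -> sB; exists s => //; apply: le_trans sB _.
  apply: (@le_trans _ _ (`|K| * enorm w ^+ 3)).
    by rewrite ler_wpM2r ?exprn_ge0 ?sqrtr_ge0// ler_norm.
  rewrite /e -mulrA -exprMn ler_wpM2l// lerXn2r ?nnegrE ?sqrtr_ge0 ?mulr_ge0//.
  by rewrite mulrC.
set S := [set drift D p W w | w in box A rho].
have up : (ereal_sup S <= (rho ^+ 2 * M 1 + e)%:E)%E.
  apply: ge_ereal_sup => _ [w bw <-]; have [s -> ] := near w bw.
  rewrite lee_fin ler_norml => /andP[_ ?].
  by have := fisher_drift_le rho0 bw; lra.
have lowS w : box A rho w -> ((drift2 w - e)%:E <= ereal_sup S)%E.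
  move=> bw; have [s sE] := near w bw; rewrite ler_norml => /andP[? _].
  apply: (@le_trans _ _ s%:E); first by rewrite lee_fin; lra.
  by apply: ereal_sup_ubound; exists w.
have low : ((rho ^+ 2 * M 1 - e)%:E <= ereal_sup S)%E.
  (* The zero update rules out the value [-oo]. *)
  move: up lowS; case: (ereal_sup S) => [s| |]// up lowS; last first.
    by have := lowS 0 (box0 rho0).
  rewrite lee_fin lerBlDr -sup_fisher_driftE//.
  apply: ge_sup; first by exists (drift2 0), 0 => //; exact: box0.
  by move=> _ [w /lowS + <-]; rewrite lee_fin lerBlDr.
move: up low; case: (ereal_sup S) => [s| |]//; rewrite !lee_fin => ? ?.
by rewrite ler_norml; apply/andP; split; lra.
Qed.

End Scaling.

Section Cells.
Variables (R : realType) (N : nat) (A : artifact R N).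
Hypothesis hA : cells A (anchor A).

Lemma room_le_half_Delta i : room A i <= Delta A i / 2.
Proof. exact: min_room_le. Qed.

Lemma bounded_fill_box : bounded_fill A `<=` box A 1.
Proof.
by move=> w bw i; rewrite mul1r; apply: le_trans (bw i) (room_le_half_Delta i).
Qed.

(** Places the fill inside the smoothness domain, which lying in the box of radius 1 would not do
    where a cell is asymmetric. *)
Lemma bounded_fill_cells w : bounded_fill A w -> cells A (anchor A + w).
Proof.
move=> bw i; have := bw i; rewrite mxE /room le_min !ler_norml.
by move=> /andP[/andP[? ?] /andP[? ?]]; apply/andP; split; lra.
Qed.

Lemma projected_update_le_reach V i :
  `|projected_update A V ord0 i| <= reach A i.
Proof. by have := norm_clamp_le (hA i) (V ord0 i); rewrite /reach !mxE. Qed.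

Lemma projected_update_reach :
  exists V, forall i, `|projected_update A V ord0 i| = reach A i.
Proof.
exists (\row_i if anchor A ord0 i - ell A i <= upp A i - anchor A ord0 i
  then upp A i else ell A i) => i.
by have := norm_clamp_farthest (hA i); rewrite /reach !mxE.
Qed.

Lemma half_Delta_lt_reach i : (Delta A i / 2 < reach A i) = asymmetric A i.
Proof.
by rewrite [LHS]half_lt_max /asymmetric /cell_asymmetric !mxE.
Qed.

(** One projected update attains [reach] in every coordinate, and [reach] exceeds the half-width
    exactly at the asymmetric cells. *)
Lemma asymmetric_iff_leaves_box :
  (exists i, asymmetric A i) <-> (exists V, ~ box A 1 (projected_update A V)).
Proof.
split=> [[i asym]|[V nbox]].
  have [V HV] := projected_update_reach; exists V => /(_ i).
  by rewrite HV mul1r leNgt half_Delta_lt_reach asym.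
apply: contrapT => sym; apply: nbox => i.
rewrite mul1r (le_trans (projected_update_le_reach V i))// leNgt.
by rewrite half_Delta_lt_reach; apply/negP => asym; apply: sym; exists i.
Qed.

Lemma symmetric_part_box (t : 'I_N -> R) w :
  (forall i, 0 <= t i <= Delta A i / 2) -> box A 1 (symmetric_part t w).
Proof.
move=> ht i; have /andP[t0 tD] := ht i.
by rewrite mxE mul1r (le_trans (norm_symmetric_clamp_le _ t0)).
Qed.

Lemma symmetric_part_cells (t : 'I_N -> R) V : (forall i, 0 <= t i) ->
  cells A (anchor A + symmetric_part t (projected_update A V)).
Proof.
move=> t0 i; have := symmetric_clamp_in (hA i) (V ord0 i) (t0 i).
by rewrite !mxE.
Qed.

End Cells.

(** * The NF4 level table *)

Section NF4.
Variable R : realType.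

(** Capping centres the cell on its level and the margin is the same at both ends, so the level
    table is arbitrary. *)
Lemma extreme_codes_symmetric (L : 16.-tuple R) (s : R) (a : 'I_16) :
  (a == ord0) || (a == ord_max) -> ~~ cell_asymmetric L s a.
Proof.
move=> /orP[]/eqP ->; rewrite /cell_asymmetric negbK; apply/eqP;
  rewrite /cell_anchor /cell_ell /cell_u /lo /hi /unit_lo /unit_hi /=.
  lra.
lra.
Qed.

Lemma nf4_increasing : sorted <%R (nf4 R).
Proof. by rewrite /nf4 /dec /=; repeat (apply/andP; split => //); lra. Qed.

Definition unit_half_lo (L : 16.-tuple R) a : R :=
  L`_(nat_of_ord a) - unit_lo L a - mu R * (unit_hi L a - unit_lo L a).
Definition unit_half_hi (L : 16.-tuple R) a : R :=
  unit_hi L a - L`_(nat_of_ord a) - mu R * (unit_hi L a - unit_lo L a).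

Lemma anchor_sub_ell (L : 16.-tuple R) s a :
  cell_anchor L s a - cell_ell L s a = s * unit_half_lo L a.
Proof. by rewrite /cell_anchor /cell_ell /lo /hi /unit_half_lo; ring. Qed.

Lemma upp_sub_anchor (L : 16.-tuple R) s a :
  cell_u L s a - cell_anchor L s a = s * unit_half_hi L a.
Proof. by rewrite /cell_anchor /cell_u /lo /hi /unit_half_hi; ring. Qed.

(** With the scale factored out, each of the sixteen codes is a linear check on explicit rationals;
    nonnegativity says that the margin does not push the anchor out of its cell. *)
Lemma nf4_unit_cell (a : 'I_16) :
  [/\ 0 <= unit_half_lo (nf4 R) a, 0 <= unit_half_hi (nf4 R) a &
      (unit_half_lo (nf4 R) a != unit_half_hi (nf4 R) a)
        = (a != ord0) && (a != ord_max)].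
Proof.
case: a; do 16 (case; first by (move=> ?;
  rewrite /unit_half_lo /unit_half_hi /unit_lo /unit_hi /midpoint /mu /nf4 /dec /= ?natn;
  split; [lra | lra |
    match goal with
    | |- _ = false => apply/negbTE; rewrite negbK; apply/eqP; lra
    | |- _ = true => apply/negP => /eqP ?; lra
    end])).
by [].
Qed.

Lemma nf4_asymmetric (s : R) (a : 'I_16) : 0 < s ->
  cell_asymmetric (nf4 R) s a = (a != ord0) && (a != ord_max).
Proof.
move=> s0; rewrite /cell_asymmetric anchor_sub_ell upp_sub_anchor.
rewrite (inj_eq (mulfI (lt0r_neq0 s0))).
by have [_ _ ->] := nf4_unit_cell a.
Qed.

Lemma nf4_anchor_in_cell (s : R) (a : 'I_16) : 0 < s ->
  cell_ell (nf4 R) s a <= cell_anchor (nf4 R) s a <= cell_u (nf4 R) s a.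
Proof.
move=> s0; have [lo0 hi0 _] := nf4_unit_cell a.
have s_ge0 := ltW s0.
by apply/andP; split; rewrite -subr_ge0 ?anchor_sub_ell ?upp_sub_anchor mulr_ge0.
Qed.

Lemma card_nf4_asymmetric (s : R) : 0 < s ->
  #|[pred a : 'I_16 | cell_asymmetric (nf4 R) s a]| = 14%N.
Proof.
move=> s0; rewrite (eq_card (fun a => nf4_asymmetric a s0 :
  _ = [pred a | (a != ord0) && (a != ord_max)] a)).
by rewrite -sum1_card big_mkcond/= !big_ord_recl big_ord0.
Qed.

End NF4.

(** * Drift of the artifact: expansion, scaling, and the updates covered *)

Theorem proposition5 (R : realType) (N : nat) (A : artifact R N)
  (hA : cells A (anchor A))
  (d : measure_display) (X : measurableType d) (D : probability X R)
  (Y : finType) (p : 'rV[R]_N -> X -> Y -> R) (U : set 'rV[R]_N)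
  (hU : open U) (hCU : cells A `<=` U)
  (hp : smooth_model p U)
  (hreg : regular_expectations D p U (anchor A)) :
  [/\ (* second-order expansion on the box of radius rho: as delta tends to 0;
         uniformly as long as the updated weights stay in the cells; uniformly
         on the whole box when the model is smooth there *)
      (forall rho : R, 0 <= rho <= 1 ->
        [/\ exists2 r : R, 0 < r &
              fisher_expansion_on D p (anchor A)
                [set delta | box A rho delta /\ enorm delta <= r],
            fisher_expansion_on D p (anchor A)
              [set delta | box A rho delta /\ cells A (anchor A + delta)] &
            (forall delta, box A rho delta -> U (anchor A + delta)) ->
              fisher_expansion_on D p (anchor A) (box A rho)]),
      (* control by the Fisher form, and scaling as rho^2 *)
      (let M (rho : R) :=
         sup [set fisher_drift D p (anchor A) delta | delta in box A rho] in
       [/\ forall rho : R, 0 <= rho <= 1 -> M rho = rho ^+ 2 * M 1,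
           forall (rho : R) (delta : 'rV[R]_N), 0 <= rho <= 1 -> box A rho delta ->
             fisher_drift D p (anchor A) delta <= rho ^+ 2 * M 1 &
           exists K rho0 : R, 0 < rho0 /\
             forall rho : R, 0 <= rho <= rho0 ->
               (`| ereal_sup [set drift D p (anchor A) delta
                             | delta in box A rho]
                   - (rho ^+ 2 * M 1)%:E | <= (K * rho ^+ 3)%:E)%E]),
      (* (a) bounded fill *)
      [/\ forall i, room A i <= Delta A i / 2,
          bounded_fill A `<=` box A 1,
          (forall delta, bounded_fill A delta -> cells A (anchor A + delta)) &
          fisher_expansion_on D p (anchor A) (bounded_fill A)],
      (* (b) projected paths *)
      [/\ forall V i, `|projected_update A V ord0 i| <= reach A i,
          exists V, forall i, `|projected_update A V ord0 i| = reach A i,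
          forall i, (Delta A i / 2 < reach A i) = asymmetric A i,
          (exists i, asymmetric A i) <->
            (exists V, ~ box A 1 (projected_update A V)) &
          forall t : 'I_N -> R, (forall i, 0 <= t i <= Delta A i / 2) ->
            let S := [set symmetric_part t (projected_update A V)
                     | V in [set: 'rV[R]_N]] in
            S `<=` box A 1 /\ fisher_expansion_on D p (anchor A) S] &
      (* the codes concerned by (b) *)
      [/\ forall (L : 16.-tuple R) (s : R) (a : 'I_16),
            (a == ord0) || (a == ord_max) -> ~~ cell_asymmetric L s a,
          sorted <%R (nf4 R),
          forall (s : R) (a : 'I_16), 0 < s ->
            cell_ell (nf4 R) s a <= cell_anchor (nf4 R) s a <= cell_u (nf4 R) s a,
          forall (s : R) (a : 'I_16), 0 < s ->
            cell_asymmetric (nf4 R) s a = (a != ord0) && (a != ord_max) &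
          forall s : R, 0 < s ->
            #|[pred a : 'I_16 | cell_asymmetric (nf4 R) s a]| = 14%N]].
Proof.
have UW : U (anchor A) by exact: hCU.
have on_cells : fisher_expansion_on D p (anchor A)
    [set w | cells A (anchor A + w)].
  exact: (fisher_expansion_on_rect hU hp hreg hCU hA).
(* Needed because the box may leave the cells: near the anchor, openness of [U] replaces the cell
   constraint. *)
have on_ball : exists2 r : R, 0 < r &
    fisher_expansion_on D p (anchor A) [set w | enorm w <= r].
  have [r r0 rU] := open_rect hU UW; exists r => //.
  have rW : rect (fun i => anchor A ord0 i - r) (fun i => anchor A ord0 i + r)
      (anchor A) by move=> i; apply/andP; split; lra.
  apply: fisher_expansion_onS (fisher_expansion_on_rect hU hp hreg rU rW).
  move=> w /= wr i; have := le_trans (norm_coord_le_enorm w i) wr.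
  by rewrite [(anchor A + w) ord0 i]mxE ler_norml => /andP[? ?]; apply/andP; split; lra.
split.
- move=> rho /andP[rho0 rho1]; split.
  + have [r r0 Hr] := on_ball; exists r => //.
    by apply: fisher_expansion_onS Hr => w [].
  + by apply: fisher_expansion_onS on_cells => w [].
  + move=> boxU.
    pose h i := rho * Delta A i / 2.
    (* Passes from a set of updates to a compact rectangle of weights, which [boxU] places inside
       [U]. *)
    have boxE w : box A rho w <-> rect (fun i => anchor A ord0 i - h i)
        (fun i => anchor A ord0 i + h i) (anchor A + w).
      split=> Hw i; have := Hw i;
        rewrite [(anchor A + w) ord0 i]mxE ler_norml -/(h i);
        by move=> /andP[? ?]; apply/andP; split; lra.
    have rU : rect (fun i => anchor A ord0 i - h i)
        (fun i => anchor A ord0 i + h i) `<=` U.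
      move=> v rv; rewrite -(subrK (anchor A) v) addrC.
      by apply/boxU/boxE; rewrite addrC subrK.
    apply: fisher_expansion_onS (fisher_expansion_on_rect hU hp hreg rU _).
      by move=> w /boxE.
    by have /boxE := box0 hA rho0; rewrite addr0.
- split.
  + by move=> rho /andP[rho0 _]; exact: sup_fisher_driftE.
  + by move=> rho w /andP[rho0 _]; exact: fisher_drift_le.
  + have [r r0 Hr] := on_ball; apply: (ereal_sup_drift_scaling hA r0).
    by apply: fisher_expansion_onS Hr => w [].
- split.
  + exact: room_le_half_Delta.
  + exact: bounded_fill_box.
  + exact: bounded_fill_cells.
  + by apply: fisher_expansion_onS on_cells; exact: bounded_fill_cells.
- split.
  + exact: projected_update_le_reach.
  + exact: projected_update_reach.
  + exact: half_Delta_lt_reach.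
  + exact: asymmetric_iff_leaves_box.
  + move=> t ht S; split; first by move=> _ [V _ <-]; exact: symmetric_part_box.
    apply: fisher_expansion_onS on_cells => _ [V _ <-].
    by apply: symmetric_part_cells => // i; have /andP[] := ht i.
- split.
  + exact: extreme_codes_symmetric.
  + exact: nf4_increasing.
  + exact: nf4_anchor_in_cell.
  + exact: nf4_asymmetric.
  + exact: card_nf4_asymmetric.
Qed.
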